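(* Let $G_p$ and $G_c$ be IF-OFP systems with passivity indices $(\nu_p,\rho_p)$ and $(\nu_c,\rho_c)$ respectively, interconnected in the controller-side event-triggered feedback loop described in the context, where the triggering instants $t_k$ are determined by the condition $\|e_c(t)\|_2^2>\delta\|y_c(t)\|_2^2$ with $\delta\in(0,1]$. Let $$\beta(\nu_p)=\begin{cases}\rho_c-\nu_p-\delta(1+\nu_p)&\text{if }\nu_p>0,\\ \rho_c-\delta&\text{if }\nu_p=0,\\ \rho_c+2\nu_p-\delta(1-3\nu_p)&\text{if }\nu_p<0.\end{cases}$$ Then the networked control system is passive from the inputs $w=\begin{bmatrix} w_1 \\ w_2 \end{bmatrix}$ to the outputs $y=\begin{bmatrix} y_p \\ y_c \end{bmatrix}$ with input passivity index $\epsilon_0$ and output passivity index $\delta_0$, that is, $$\dot V(t)\le w^T(t)y(t)-\epsilon_0\,w^T(t)w(t)-\delta_0\,y^T(t)y(t)$$ for a storage function $V$ of the interconnection, where $$\epsilon_0<\min(\nu_c,\ \nu_p-|\nu_p|),\qquad \delta_0<\min\Big(\beta(\nu_p)-\frac{\nu_p^2}{\nu_p-|\nu_p|-\epsilon_0},\ \rho_p+\nu_c-\frac14-\frac{\nu_c^2}{\nu_c-\epsilon_0}\Big).$$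
   Context: Systems: a system $G$ has the form $\dot x=f(x,u)$, $y=h(x,u)$ with state $x\in X\subset\mathbb{R}^n$ and $u(t),y(t)\in\mathbb{R}^m$. A storage function is a nonnegative function $V$ of the state; it is taken differentiable, and $\dot V(t)$ is the time derivative along solutions. $G$ is IF-OFP (input feed-forward output feedback passive) with input passivity index $\nu\in\mathbb{R}$ and output passivity index $\rho\in\mathbb{R}$ (of either sign) if there is a storage function $V$ with $\dot V\le u^Ty-\rho y^Ty-\nu u^Tu$ for all $t$ along all solutions. Controller-side event-triggered loop: $G_p$ (plant, state $x_p$, input $u_p$, output $y_p$) has indices $(\nu_p,\rho_p)$, and $G_c$ (controller, state $x_c$, input $u_c$, output $y_c$) has indices $(\nu_c,\rho_c)$; all inputs and outputs are $\mathbb{R}^m$-valued. External signals $w_1,w_2$ are $\mathbb{R}^m$-valued. At event instants $t_k$ the controller output is sampled and sent to the plant, and is held constant until the next event. For $t\in[t_k,t_{k+1})$: $u_c(t)=w_2(t)+y_p(t)$, $u_p(t)=w_1(t)-y_c(t_k)$, $e_c(t)=y_c(t)-y_c(t_k)$ (so $u_p=w_1+e_c-y_c$). A new event is triggered as soon as $\|e_c(t)\|_2^2>\delta\|y_c(t)\|_2^2$ (Euclidean norm of the vectors at time $t$), so that $e_c^T(t)e_c(t)\le\delta\, y_c^T(t)y_c(t)$ holds at all times. A storage function of the interconnection is a nonnegative function $V$ of $(x_p,x_c)$; inequalities on $\dot V$ are required along all solutions for all $t$ in the intervals $[t_k,t_{k+1})$. The indices $\epsilon_0,\delta_0$ may be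 of either sign. *)

(* Defs.v *)
From HB Require Import structures.
From mathcomp Require Export all_boot all_order all_algebra.
From mathcomp Require Export all_classical all_reals all_analysis.
Export Order.TTheory GRing.Theory Num.Theory numFieldNormedType.Exports.

Set Implicit Arguments.
Unset Strict Implicit.
Unset Printing Implicit Defensive.

Local Open Scope classical_set_scope.
Local Open Scope ring_scope.

Definition dot (R : realType) (m : nat) (u v : 'cV[R]_m) : R :=
  (u^T *m v) 0 0.

(* The library norm on 'cV[R]_m is the sup norm, hence a separate Euclidean
   norm. *)
Definition enorm (R : realType) (m : nat) (u : 'cV[R]_m) : R :=
  Num.sqrt (dot u u).

(* [a, b[ with b possibly +oo *)
Definition ico (R : realType) (a : R) (b : \bar R) : set R :=
  [set t | a <= t /\ (t%:E < b)%E].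

(* Time derivatives are taken from the right: inputs may jump (the plant input
   does so at every event), and at a jump the state has only one-sided
   derivatives.  Where the two-sided derivative exists, it is this one. *)
Definition rderivable (R : realType) (Z : normedModType R)
    (z : R -> Z) (t : R) : Prop :=
  cvg (h^-1 *: (z (t + h) - z t) @[h --> 0^'+]).

Definition rderive (R : realType) (Z : normedModType R)
    (z : R -> Z) (t : R) : Z :=
  lim (h^-1 *: (z (t + h) - z t) @[h --> 0^'+]).

(* x' = f(x, u), y = h(x, u); the values of f and h outside X are never used. *)
Record system (R : realType) (n m : nat) := System {
  states : set 'cV[R]_n;
  dyn : 'cV[R]_n -> 'cV[R]_m -> 'cV[R]_n;
  out : 'cV[R]_n -> 'cV[R]_m -> 'cV[R]_m }.

Definition solution (R : realType) (n m : nat) (G : system R n m)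
    (a : R) (b : \bar R) (x : R -> 'cV[R]_n) (u y : R -> 'cV[R]_m) : Prop :=
  {within ico a b, continuous x} /\
  forall t, ico a b t ->
    [/\ states G (x t),
        rderivable x t,
        rderive x t = dyn G (x t) (u t) &
        y t = out G (x t) (u t)].

Definition storage_function (R : realType) (Z : normedModType R)
    (X : set Z) (V : Z -> R) : Prop :=
  forall z, X z -> 0 <= V z /\ differentiable V z.

Definition IF_OFP (R : realType) (n m : nat) (G : system R n m)
    (nu rho : R) : Prop :=
  exists V : 'cV[R]_n -> R,
    storage_function (states G) V /\
    forall (a : R) (b : \bar R) (x : R -> 'cV[R]_n) (u y : R -> 'cV[R]_m),
      solution G a b x u y ->
      forall t, ico a b t ->
        rderive (V \o x) t
          <= dot (u t) (y t) - rho * dot (y t) (y t) - nu * dot (u t) (u t).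

Record signals (R : realType) (np nc m : nat) := Signals {
  xp : R -> 'cV[R]_np; up : R -> 'cV[R]_m; yp : R -> 'cV[R]_m;
  xc : R -> 'cV[R]_nc; uc : R -> 'cV[R]_m; yc : R -> 'cV[R]_m }.

(* The loop on [a, b[ while the plant receives the constant controller
   output c. *)
Definition held_loop (R : realType) (np nc m : nat)
    (Gp : system R np m) (Gc : system R nc m) (w1 w2 : R -> 'cV[R]_m)
    (c : 'cV[R]_m) (a : R) (b : \bar R) (s : signals R np nc m) : Prop :=
  [/\ solution Gp a b (xp s) (up s) (yp s),
      solution Gc a b (xc s) (uc s) (yc s) &
      forall t, ico a b t -> uc s t = w2 t + yp s t /\ up s t = w1 t - c].

Definition agree (R : realType) (np nc m : nat) (A : set R)
    (s s' : signals R np nc m) : Prop :=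
  forall t, A t ->
    [/\ xp s t = xp s' t, up s t = up s' t & yp s t = yp s' t] /\
    [/\ xc s t = xc s' t, uc s t = uc s' t & yc s t = yc s' t].

(* The times of [a, b[ at which the error with respect to the sample c exceeds
   the threshold. *)
Definition violations (R : realType) (m : nat) (delta : R) (y : R -> 'cV[R]_m)
    (c : 'cV[R]_m) (a : R) (b : \bar R) : set R :=
  [set t | ico a b t /\ enorm (y t - c) ^+ 2 > delta * enorm (y t) ^+ 2].

(* b is the event instant that follows the event instant a: were the sample
   taken at a held beyond b, b would be the infimum of the violation times.
   This has to be read on a continuation s' of the held loop, because from b on
   the actual signals s are driven by the next sample. *)
Definition next_event (R : realType) (np nc m : nat)
    (Gp : system R np m) (Gc : system R nc m) (delta : R)
    (w1 w2 : R -> 'cV[R]_m) (s : signals R np nc m) (a b : R) : Prop :=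
  exists (b' : R) (s' : signals R np nc m),
    let viol := violations delta (yc s') (yc s a) a b'%:E in
    [/\ held_loop Gp Gc w1 w2 (yc s a) a b'%:E s',
        agree (ico a b%:E) s s',
        viol !=set0 &
        inf viol = b].

(* The event-triggered loop on [0, T[, with event instants tk 0 = 0, tk 1, ...;
   if there are only finitely many events, tk is eventually equal to T.
   T = +oo is allowed. *)
Definition event_triggered_loop (R : realType) (np nc m : nat)
    (Gp : system R np m) (Gc : system R nc m) (delta : R)
    (w1 w2 : R -> 'cV[R]_m) (T : \bar R) (tk : nat -> \bar R)
    (s : signals R np nc m) : Prop :=
  [/\ tk 0%N = 0%E,
      forall k, (tk k <= tk k.+1)%E /\ (tk k.+1 <= T)%E,
      forall k, {within ico 0 (tk k), continuous (xp s)} /\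
                {within ico 0 (tk k), continuous (xc s)} &
      forall (k : nat) (a : R), tk k = a%:E -> (a%:E < T)%E ->
        [/\ (a%:E < tk k.+1)%E,
            held_loop Gp Gc w1 w2 (yc s a) a (tk k.+1) s &
            (exists2 b, tk k.+1 = b%:E & next_event Gp Gc delta w1 w2 s a b) \/
            (tk k.+1 = T /\ violations delta (yc s) (yc s a) a T = set0)]].

Definition beta (R : realType) (rhoc delta nup : R) : R :=
  if nup > 0 then rhoc - nup - delta * (1 + nup)
  else if nup == 0 then rhoc - delta
  else rhoc + 2 * nup - delta * (1 - 3 * nup).

(* Main.v *)
From mathcomp Require Import ring lra.
Require Import Defs.
Set Implicit Arguments.
Unset Strict Implicit.
Unset Printing Implicit Defensive.
Local Open Scope classical_set_scope.
Local Open Scope ring_scope.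

(** The storage function of the loop is the sum [Vp + Vc] of storage functions
    of the plant and of the controller.  At each time [t] the hypotheses on
    [Gp] and [Gc] bound its right derivative by the sum of the two supply
    rates ([rderive_sum_pair]), so everything reduces to an inequality between
    quadratic forms in the values of the signals at [t]
    ([supply_rate_bound]).

    Let [c] be the sample that the plant receives and [e = yc - c].  With
    [up = w1 + e - yc] and [uc = w2 + yp] the feedback terms cancel:
    [up . yp + uc . yc = w . y + e . yp].  Three groups of terms remain to be
    estimated.
    - [e . yp <= e . e + (1 / 4) yp . yp] accounts for the [1 / 4] in the bound
      on [delta0] ([error_coupling_bound]).
    - In [- nuc |w2 + yp|^2], Young's inequality with weight [nuc - eps0] on
      [w2] leaves exactly [- eps0 |w2|^2] ([controller_feedforward_bound]).
    - In [- nup |w1 + e - yc|^2], the cross terms with [e] are absorbed by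
      squares of the sign that [nup] allows, and the cross term [w1 . yc] by
      Young's inequality with weight [nup - |nup| - eps0]
      ([plant_feedforward_bound]); the three cases of [beta] come from here.

    The error enters the last estimate and the first one through
    [e . e <= delta (yc . yc)], which is what the triggering rule guarantees
    strictly before the next event ([error_le_threshold]). *)

(** * Right derivatives along trajectories *)

(** The chain rule for a right derivative.  With [d h = x (t + h) - x t], the
    quotient of [V \o x] is ['d V] applied to [h^-1 *: d h] plus
    [h^-1 *: r (d h)], where [r] is the remainder of [V] at [x t].  Since
    [h^-1 *: d h] is bounded near [0], [r (d h)] is negligible with respect
    to [h]. *)
Lemma cvg_rderive_comp (R : realType) (Z W : normedModType R)
    (V : Z -> W) (x : R -> Z) (t : R) :
  rderivable x t -> differentiable V (x t) ->
  h^-1 *: (V (x (t + h)) - V (x t)) @[h --> 0^'+] --> 'd V (x t) (rderive x t).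
Proof.
move=> xt dV; set L := rderive x t.
pose d h := x (t + h) - x t; pose q h := h^-1 *: d h.
have qL : q h @[h --> 0^'+] --> L by exact: xt.
have dq h : 0 < h -> d h = h *: q h.
  by move=> h0; rewrite /q scalerA divff ?gt_eqF// scale1r.
have d0 : d h @[h --> 0^'+] --> (0 : Z).
  have h0 : (h : R) @[h --> 0^'+] --> (0 : R) by exact: cvg_within.
  rewrite -(scale0r L); apply: cvg_trans (cvgZ h0 qL); apply: near_eq_cvg.
  by near=> h; rewrite -dq.
pose r k := V (k + x t) - (V (x t) + 'd V (x t) k).
have ro e : 0 < e -> \forall k \near (0 : Z), `|r k| <= e * `|k|.
  by have /eqaddoP/[apply] := diff_locally dV.
have -> : (fun h => h^-1 *: (V (x (t + h)) - V (x t))) =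
          (fun h => 'd V (x t) (q h) + h^-1 *: r (d h)).
  apply/funext => h; rewrite linearZ -scalerDr; congr (_ *: _).
  rewrite /r /d subrK [RHS]addrC opprD addrA; exact: esym (addrNK _ _).
rewrite -[X in _ --> X]addr0; apply: cvgD.
  by apply: continuous_cvg qL; apply: diff_continuous.
apply/cvgr0Pnorm_le => e e0.
have L1 : 0 < `|L| + 1 by rewrite ltr_wpDl.
near=> h.
have h0 : 0 < h by near: h; exact: nbhs_right_gt.
rewrite normrZ normfV (gtr0_norm h0) ler_pdivrMl//.
(* |L| + 1 eventually bounds |h^-1 *: d h| *)
have /le_trans -> // : `|r (d h)| <= e / (`|L| + 1) * `|d h|.
  by near: h; apply: (d0 _ (ro _ _)); rewrite divr_gt0.
rewrite dq// normrZ (gtr0_norm h0) mulrCA ler_pM2l//.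
rewrite mulrAC ler_pdivrMr// ler_pM2l// ltW//.
by near: h; apply: (cvgr_norm_lt L qL); rewrite ltrDl.
Unshelve. all: by end_near. Qed.

Lemma differentiable_sum_pair (R : realType) (Z1 Z2 : normedModType R)
    (V1 : Z1 -> R) (V2 : Z2 -> R) (z : Z1 * Z2) :
  differentiable V1 z.1 -> differentiable V2 z.2 ->
  differentiable (fun z => V1 z.1 + V2 z.2) z.
Proof.
move=> d1 d2; apply: differentiableD; apply: differentiable_comp => //.
- by apply: linear_differentiable => u; apply: cvg_fst.
- by apply: linear_differentiable => u; apply: cvg_snd.
Qed.

Lemma rderive_sum_pair (R : realType) (Z1 Z2 : normedModType R)
    (V1 : Z1 -> R) (V2 : Z2 -> R) (x1 : R -> Z1) (x2 : R -> Z2) (t : R) :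
  rderivable x1 t -> differentiable V1 (x1 t) ->
  rderivable x2 t -> differentiable V2 (x2 t) ->
  rderive (fun t' => V1 (x1 t') + V2 (x2 t')) t =
  rderive (V1 \o x1) t + rderive (V2 \o x2) t.
Proof.
move=> x1t dV1 x2t dV2.
have c1 := cvg_rderive_comp x1t dV1; have c2 := cvg_rderive_comp x2t dV2.
rewrite /rderive (cvg_lim _ c1)// (cvg_lim _ c2)//; apply: cvg_lim => //.
under eq_fun do rewrite opprD addrACA scalerDr.
exact: cvgD.
Qed.

(** * The Euclidean inner product *)

Section Dot.
Context (R : realType) (m : nat).
Implicit Types (u v w : 'cV[R]_m).

Lemma dotE u v : dot u v = \sum_i u i 0 * v i 0.
Proof. by rewrite /dot mxE; apply: eq_bigr => i _; rewrite mxE. Qed.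

Lemma dotC u v : dot u v = dot v u.
Proof. by rewrite !dotE; apply: eq_bigr => i _; rewrite mulrC. Qed.

Lemma dotDl u v w : dot (u + v) w = dot u w + dot v w.
Proof. by rewrite /dot linearD/= mulmxDl mxE. Qed.

Lemma dotNl u w : dot (- u) w = - dot u w.
Proof. by rewrite /dot linearN/= mulNmx mxE. Qed.

Lemma dotDr u v w : dot w (u + v) = dot w u + dot w v.
Proof. by rewrite dotC dotDl !(dotC w). Qed.

Lemma dotNr u w : dot w (- u) = - dot w u.
Proof. by rewrite dotC dotNl dotC. Qed.

Lemma dotZl a u w : dot (a *: u) w = a * dot u w.
Proof. by rewrite /dot linearZ/= -scalemxAl mxE. Qed.

Lemma dotZr a u w : dot w (a *: u) = a * dot w u.
Proof. by rewrite dotC dotZl dotC. Qed.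

Lemma dot_ge0 u : 0 <= dot u u.
Proof. by rewrite dotE; apply: sumr_ge0 => i _; rewrite -expr2 sqr_ge0. Qed.

Lemma sqr_enorm u : enorm u ^+ 2 = dot u u.
Proof. by rewrite /enorm sqr_sqrtr ?dot_ge0. Qed.

(** Expand [|c u - k v|^2 >= 0] and divide by [c].  The sign of [k] is free, so
    that one form serves for cross terms of either sign. *)
Lemma dot_young (c k : R) u v : 0 < c ->
  2 * k * dot u v <= c * dot u u + k ^+ 2 / c * dot v v.
Proof.
move=> c0; have := dot_ge0 (c *: u - k *: v).
rewrite !(dotDl, dotDr, dotNl, dotNr, dotZl, dotZr) (dotC v u) => h.
rewrite -subr_ge0 -(pmulr_rge0 _ c0).
rewrite [leRHS](_ : _ = c * (c * dot u u) - c * (2 * k * dot u v)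
   + k ^+ 2 * dot v v); last by field; rewrite gt_eqF.
by lra.
Qed.
End Dot.

Lemma dot_col_mx (R : realType) (p q : nat) (u1 v1 : 'cV[R]_p)
    (u2 v2 : 'cV[R]_q) :
  dot (col_mx u1 u2) (col_mx v1 v2) = dot u1 v1 + dot u2 v2.
Proof. by rewrite /dot tr_col_mx mul_row_col mxE. Qed.

(** * The triggering rule *)

(** The next event is the infimum of the violation times of a continuation [s']
    of the held loop, so [s'] has no violation before it, and until then [s']
    agrees with the actual signals.  If no event follows, there is no violation
    at all. *)
Lemma error_le_threshold (R : realType) (np nc m : nat) (Gp : system R np m)
    (Gc : system R nc m) (delta : R) (w1 w2 : R -> 'cV[R]_m) (T : \bar R)
    (s : signals R np nc m) (a : R) (b : \bar R) (t : R) :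
  (exists2 b', b = b'%:E & next_event Gp Gc delta w1 w2 s a b') \/
    (b = T /\ violations delta (yc s) (yc s a) a T = set0) ->
  ico a b t ->
  dot (yc s t - yc s a) (yc s t - yc s a) <= delta * dot (yc s t) (yc s t).
Proof.
rewrite -!sqr_enorm leNgt => next tab; apply/negP => bad.
case: next => [[b' bE [e [s' [_ ss' [v vviol] infE]]]]|[bT viol0]]; last first.
  by have : set0 t; [rewrite -viol0; split=> //; rewrite -bT|].
move: tab; rewrite bE => tab; have [ta] := tab; rewrite lte_fin => tb.
have lbv : has_lbound (violations delta (yc s') (yc s a) a e%:E).
  by exists a => z [[]].
(* some violation v lies between b' and e, so that t < e, where s' is defined *)
have bv : b' <= v by rewrite -infE; apply: ge_inf.
have ve : v < e by move: vviol => [[_]]; rewrite lte_fin.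
have : b' <= t.
  rewrite -infE; apply: ge_inf => //; split.
    by split => //; rewrite lte_fin (lt_le_trans tb)// (le_trans bv)// ltW.
  by have [_ [_ _ <-]] := ss' _ tab.
by rewrite leNgt tb.
Qed.

(** * Estimates of the supply rates *)

(** For [nup > 0] the terms [-2 nup (w1 . e)] and [2 nup (e . y)] are bounded by
    [nup (w1 . w1 + e . e)] and [nup (e . e + y . y)]: [w1 . w1] disappears and
    [e . e] has coefficient [1 + nup].  For [nup < 0] the same squares come
    with [- nup] and add to the positive [- nup |w1 + e - y|^2]: [w1 . w1] gets
    coefficient [-2 nup], which is [|nup| - nup], [y . y] gets [-2 nup], and
    [e . e] gets [1 - 3 nup].  The term [2 nup (w1 . y)] is left to Young's
    inequality, whose weight is what [- eps0 (w1 . w1)] leaves free. *)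
Lemma plant_feedforward_bound (R : realType) (m : nat) (w1 e y : 'cV[R]_m)
    (rhoc delta nup eps0 : R) :
  eps0 < nup - `|nup| -> dot e e <= delta * dot y y ->
  dot e e - rhoc * dot y y - nup * dot (w1 + e - y) (w1 + e - y)
  <= - eps0 * dot w1 w1
     - (beta rhoc delta nup - nup ^+ 2 / (nup - `|nup| - eps0)) * dot y y.
Proof.
rewrite -subr_gt0 => c0 he.
have := dot_young nup w1 y c0; set K := nup ^+ 2 / _ => hw.
have h1 := dot_ge0 (w1 + e); have h2 := dot_ge0 (e - y).
have h3 := dot_ge0 (w1 - e); have h4 := dot_ge0 (e + y).
have ww := dot_ge0 w1; have yy := dot_ge0 y.
move: h1 h2 h3 h4.
rewrite !(dotDl, dotDr, dotNl, dotNr) (dotC y w1) (dotC e w1) (dotC y e).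
move: hw he c0 ww yy; rewrite /beta; move: K.
move: (dot w1 w1) (dot w1 y) (dot e e) (dot y y) (dot w1 e) (dot e y).
move=> ww wy ee yy we ey K.
(* the remaining inequality is linear in the inner products once the squares
   are multiplied by |nup| and the bound on e . e by its coefficient *)
case: (ltrgt0P nup) => [n0|n0|->] hw he c0 ww0 yy0 h1 h2 h3 h4.
- have := mulr_ge0 (ltW n0) h1; have := mulr_ge0 (ltW n0) h2.
  have := mulr_ge0 (ltW n0) yy0; have : 0 <= 1 + nup by lra.
  move/ler_wpM2l => /(_ _ _ he).
  by lra.
- have n0' : 0 <= - nup by lra.
  have := mulr_ge0 n0' h3; have := mulr_ge0 n0' h4.
  have : 0 <= 1 - 3 * nup by lra.
  move/ler_wpM2l => /(_ _ _ he).
  by lra.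
- by lra.
Qed.

Lemma controller_feedforward_bound (R : realType) (m : nat) (w2 y : 'cV[R]_m)
    (nuc eps0 : R) :
  eps0 < nuc ->
  - nuc * dot (w2 + y) (w2 + y)
  <= - eps0 * dot w2 w2 - (nuc - nuc ^+ 2 / (nuc - eps0)) * dot y y.
Proof.
rewrite -subr_gt0 => c0; have := dot_young (- nuc) w2 y c0.
rewrite sqrrN; move: (nuc ^+ 2 / _) => K.
rewrite !(dotDl, dotDr) (dotC y w2).
by lra.
Qed.

Lemma error_coupling_bound (R : realType) (m : nat) (e y : 'cV[R]_m) :
  dot e y <= dot e e + 1 / 4 * dot y y.
Proof.
have := @dot_young _ _ 1 (1 / 2) e y ltr01.
rewrite divr1 !expr2.
by lra.
Qed.

(** Here [c] is the sample that the plant receives, and [y1], [y2] are the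
    outputs of the plant and of the controller.  The terms [y1 . y2] of the two
    products of input and output cancel up to the error [y2 - c], and the three
    estimates above bound what is left. *)
Lemma supply_rate_bound (R : realType) (m : nat) (w1 w2 c y1 y2 : 'cV[R]_m)
    (nup rhop nuc rhoc delta eps0 delta0 : R) :
  dot (y2 - c) (y2 - c) <= delta * dot y2 y2 ->
  eps0 < Num.min nuc (nup - `|nup|) ->
  delta0 <
     Num.min (beta rhoc delta nup - nup ^+ 2 / (nup - `|nup| - eps0))
             (rhop + nuc - 1 / 4 - nuc ^+ 2 / (nuc - eps0)) ->
  (dot (w1 - c) y1 - rhop * dot y1 y1 - nup * dot (w1 - c) (w1 - c))
  + (dot (w2 + y1) y2 - rhoc * dot y2 y2 - nuc * dot (w2 + y1) (w2 + y1))
  <= dot (col_mx w1 w2) (col_mx y1 y2)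
     - eps0 * dot (col_mx w1 w2) (col_mx w1 w2)
     - delta0 * dot (col_mx y1 y2) (col_mx y1 y2).
Proof.
rewrite !lt_min => he /andP[epsc epsp] /andP[dp dc].
have hp := plant_feedforward_bound w1 rhoc epsp he.
have hc := controller_feedforward_bound w2 y1 epsc.
have hey := error_coupling_bound (y2 - c) y1.
(* delta0 enters through the coefficients of |y1|^2 and |y2|^2 separately *)
have := ler_wpM2r (dot_ge0 y2) (ltW dp).
have := ler_wpM2r (dot_ge0 y1) (ltW dc).
move: hp hc hey; move: (beta _ _ _ - _) (nuc ^+ 2 / _) => B K.
have -> : w1 + (y2 - c) - y2 = w1 - c by rewrite addrA addrAC addrK.
move: (dot (w1 - c) (w1 - c)) (dot (w2 + y1) (w2 + y1)) (dot (y2 - c) (y2 - c)).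
move=> uu vv ee; rewrite !dot_col_mx !(dotDl, dotDr, dotNl, dotNr) (dotC y1 y2).
by lra.
Qed.

(** * Passivity of the event-triggered loop *)

Theorem theorem7 (R : realType) (np nc m : nat)
  (Gp : system R np m) (Gc : system R nc m)
  (nup rhop nuc rhoc delta eps0 delta0 : R)
  (hGp : IF_OFP Gp nup rhop) (hGc : IF_OFP Gc nuc rhoc)
  (hdelta : 0 < delta /\ delta <= 1)
  (heps0 : eps0 < Num.min nuc (nup - `|nup|))
  (hdelta0 : delta0 <
     Num.min (beta rhoc delta nup - nup ^+ 2 / (nup - `|nup| - eps0))
             (rhop + nuc - 1 / 4 - nuc ^+ 2 / (nuc - eps0))) :
  exists V : 'cV[R]_np * 'cV[R]_nc -> R,
    storage_function (states Gp `*` states Gc) V /\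
    forall (w1 w2 : R -> 'cV[R]_m) (T : \bar R) (tk : nat -> \bar R)
      (s : signals R np nc m),
      event_triggered_loop Gp Gc delta w1 w2 T tk s ->
      forall (k : nat) (t : R), (tk k <= t%:E)%E -> (t%:E < tk k.+1)%E ->
        let w := col_mx (w1 t) (w2 t) in
        let y := col_mx (yp s t) (yc s t) in
        rderive (fun t' => V (xp s t', xc s t')) t
          <= dot w y - eps0 * dot w w - delta0 * dot y y.
Proof.
have [Vp [sVp dissp]] := hGp; have [Vc [sVc dissc]] := hGc.
exists (fun z => Vp z.1 + Vc z.2); split.
  move=> z [/= /sVp[Vp0 dVp] /sVc[Vc0 dVc]]; split; first exact: addr_ge0.
  exact: differentiable_sum_pair.
move=> w1 w2 T tk s [tk0 tk_mono _ loop] k t tkt ttk /=.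
have tk_ge0 j : (0%E <= tk j)%E.
  by elim: j => [|j /le_trans->//]; [rewrite tk0|have [] := tk_mono j].
have [a tka] : exists a, tk k = a%:E.
  case: (tk k) (tk_ge0 k) tkt => [a _ _|//|//]; by exists a.
have aT : (a%:E < T)%E.
  by rewrite -tka (le_lt_trans tkt)// (lt_le_trans ttk)//; have [] := tk_mono k.
have [_ [solp solc io] next] := loop k a tka aT.
have tab : ico a (tk k.+1) t by split => //; rewrite -lee_fin -tka.
have [[Xp xpt _ _] [Xc xct _ _]] := (solp.2 t tab, solc.2 t tab).
have [_ dVp] := sVp _ Xp; have [_ dVc] := sVc _ Xc.
rewrite (rderive_sum_pair xpt dVp xct dVc).
have hp := dissp _ _ _ _ _ solp t tab; have hc := dissc _ _ _ _ _ solc t tab.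
apply: le_trans (lerD hp hc) _; have [-> ->] := io t tab.
exact: supply_rate_bound (error_le_threshold next tab) heps0 hdelta0.
Qed.
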